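(* Let $q\geq 5$ be a prime and let $G=C_3\oplus C_{3q}$. Then $\mathsf c_0(G)=3q+3$.
   Context: $C_n$ denotes the cyclic group of order $n$; groups are finite abelian and written additively. A sequence over $G$ is a finite unordered sequence (multiset) of elements of $G$, repetition allowed; its length $|S|$ is the number of terms counted with multiplicity. For a sequence $S$ over $G$, $\sum(S)$ is the set of all sums $\sigma(T)$ of terms of nonempty subsequences $T$ of $S$. $S$ is an additive basis of $G$ if $\sum(S)=G$, i.e. every element of $G$ (including $0$) is the sum of a nonempty subsequence of $S$. For a subgroup $H$ of $G$, $S_H$ denotes the subsequence of $S$ consisting of all terms of $S$ (with multiplicity) lying in $H$. $S$ is regular if $|S_H|\leq |H|-1$ for every proper subgroup $H\subsetneq G$ (including the trivial subgroup, so $0$ is not a term of $S$ when $G$ is nontrivial). $\mathsf c_0(G)$ is the smallest integer $t$ such that every regular sequence $S$ over $G$ of length $|S|\geq t$ is an additive basis of $G$. *)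

(* Defs.v *)
From HB Require Import structures.
From mathcomp Require Import all_boot all_order all_algebra.

Set Implicit Arguments.
Unset Strict Implicit.
Unset Printing Implicit Defensive.

Import GRing.Theory.
Local Open Scope ring_scope.

(* Joins the componentwise additive group structure of the library with its  *)
(* finite type structure, so that U * V is the direct sum of U and V.         *)
HB.instance Definition _ (U V : finZmodType) := Finite.on (U * V)%type.

(* A sequence over G (a finite multiset of terms) is represented by a list;   *)
(* every notion below is invariant under permutation of the list.             *)

Definition subsums (G : finZmodType) (S : seq G) : {set G} :=
  [set \sum_(i in I) S`_i | I : {set 'I_(size S)} & I != set0].

Definition additive_basis (G : finZmodType) (S : seq G) : Prop :=
  subsums S = [set: G].

Definition restr (G : finZmodType) (H : {set G}) (S : seq G) : seq G :=
  [seq x <- S | x \in H].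

(* zmod_closed H says that H is a subgroup: it contains 0 and is closed under *)
(* subtraction.                                                               *)
Definition regular (G : finZmodType) (S : seq G) : Prop :=
  forall H : {set G}, zmod_closed H -> H \proper [set: G] ->
    (size (restr H S) <= #|H| - 1)%N.

Definition c0_bound (G : finZmodType) (t : nat) : Prop :=
  forall S : seq G, regular S -> (t <= size S)%N -> additive_basis S.

(* c_0(G) = t.  Taking t in nat loses nothing: sizes are nonnegative, and     *)
(* over a nontrivial G the empty sequence is regular but not a basis.         *)
Definition is_c0 (G : finZmodType) (t : nat) : Prop :=
  c0_bound G t /\ forall t' : nat, c0_bound G t' -> (t <= t')%N.

(* Main.v *)
Require Import Defs.
From HB Require Import structures.
From mathcomp Require Import all_boot all_order all_algebra.
From mathcomp Require Import zify ring.

(* Lower bound: a = (0, 1) taken 3q - 2 times and b = (1, 1) taken 4 times    *)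
(* form a regular sequence; i a + j b = (2, 1) with j <= 4 forces j = 2 and   *)
(* then i = -1 mod 3q, which is out of range.                                 *)
(*                                                                            *)
(* Upper bound: let pi : G -> C_3^2 be the projection with kernel C_q, and    *)
(* call two terms outside the kernel collinear if their images agree up to    *)
(* sign.  Among the subsums of three collinear terms some two differ by a     *)
(* nonzero kernel element (unless the terms agree up to sign and have order   *)
(* 3, which regularity forbids), so adding such a triple to a sequence        *)
(* enlarges the part of the sumset over each point of C_3^2 until it fills    *)
(* the fiber; a nonzero kernel term does the same by itself.  If S has n0     *)
(* terms in the kernel, then q - 1 - n0 triples can be removed, always from a *)
(* largest line, so that at least 6 terms remain, of which at least two lie   *)
(* off each line.  Their subsums meet every fiber: two collinear terms and    *)
(* two terms off their line reach everything, and a fifth term makes the      *)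
(* subsums nonempty.                                                          *)

Set Implicit Arguments.
Unset Strict Implicit.
Unset Printing Implicit Defensive.

Import GRing.Theory.
Local Open Scope ring_scope.

(** The upper bound follows how the sumset fills the fibers of pi, each of size q. Regularity is
    applied to four kinds of subgroup: 0, the kernel, {0, a, -a} with 3a = 0, and the preimage of a
    line ([regular_additive_basis]). Every fiber starts with at least one sum ([V_cover]) and gains
    one, up to q, for each nonzero kernel term or collinear triple ([fiber_step], fed by
    [triple_step]). So 3(q - 1 - n0) + 6 terms outside the kernel are enough, and S has at least 3q
    + 3 - n0 of them. The sequence in [c0_lower] has length 3q + 2. *)

Local Notation V := ('Z_3 * 'Z_3)%type.

(** * Linear algebra in the plane over ['Z_3] *)

Lemma pair_mulrn (U W : nmodType) (x : U) (y : W) (n : nat) :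
  (x, y) *+ n = (x *+ n, y *+ n).
Proof. by elim: n => // n IH; rewrite !mulrS IH. Qed.

Lemma mulr3n_eq0 (G : zmodType) (a : G) : a *+ 3 = 0 -> a + a = - a.
Proof. by move=> a3; apply/eqP; rewrite -addr_eq0 -a3 !mulrS addr0 addrA. Qed.

Lemma Z3_cases (x : 'Z_3) : x \in [:: 0; 1; -1].
Proof. by case: x => [[|[|[|]]]]. Qed.

(** Smallest case of Cauchy-Davenport: {0, d1} + {0, d2} has at least 3 elements. *)
Lemma Z3_cover (d1 d2 c : 'Z_3) : d1 != 0 -> d2 != 0 ->
  exists b1 b2 : bool, c = d1 *+ b1 + d2 *+ b2.
Proof.
move: (Z3_cases d1) (Z3_cases d2) (Z3_cases c); rewrite !inE.
case/or3P=> /eqP -> // /or3P[] /eqP -> // /or3P[] /eqP -> // _ _;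
  [exists false, false | exists true, false | exists true, true
  |exists false, false | exists true, false | exists false, true
  |exists false, false | exists false, true | exists true, false
  |exists false, false | exists true, true | exists true, false];
  exact/val_inj.
Qed.

Definition V_list : seq V :=
  [seq (i, j) | i <- [:: 0; 1; -1] : seq 'Z_3, j <- [:: 0; 1; -1] : seq 'Z_3].

Lemma V_forall (P : pred V) : all P V_list -> forall v, P v.
Proof.
by move=> /allP h [i j]; exact: h (allpairs_f _ (Z3_cases i) (Z3_cases j)).
Qed.

Lemma V_3 (v : V) : v *+ 3 = 0.
Proof. by apply/eqP; move: v; apply: V_forall; vm_compute. Qed.

(** For nonzero vectors of [V] this is spanning the same line, as the nonzero scalars are 1 and -1.
    It is stated for any group because it is also applied to terms of G. *)
Definition collinear (G : zmodType) (v w : G) := (w == v) || (w == - v).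

Lemma collinear_trans (G : zmodType) (r v w : G) :
  collinear r v -> collinear r w -> collinear v w.
Proof.
by rewrite /collinear => /pred2P[] -> /pred2P[] ->; rewrite ?opprK eqxx ?orbT.
Qed.

(** {0, r, -r} is a subgroup when 3r = 0. This serves both the subgroups of order 3 in G and the
    preimages of lines of [V]. *)
Lemma collinear_sub (G : zmodType) (r v w : G) : r *+ 3 = 0 ->
  (v == 0) || collinear r v -> (w == 0) || collinear r w ->
  (v - w == 0) || collinear r (v - w).
Proof.
move=> /mulr3n_eq0 r2; have Nr2 : - r - r = r by rewrite -opprD r2 opprK.
case/or3P=> /eqP -> /or3P[] /eqP ->; rewrite /collinear;
  by rewrite ?subr0 ?sub0r ?opprK ?subrr ?addNr ?r2 ?Nr2 !eqxx ?orbT.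
Qed.

Definition V_det (v w : V) : 'Z_3 := v.1 * w.2 - v.2 * w.1.

Lemma V_det_eq0 (v w : V) : v != 0 -> V_det v w = 0 -> (w == 0) || collinear v w.
Proof.
move=> vn0 /eqP vw.
pose P v w := (v != 0) ==> (V_det v w == 0) ==> ((w == 0) || collinear v w).
have H : all (fun v => all (P v) V_list) V_list by vm_compute.
exact: implyP (implyP (V_forall (V_forall H v) w) vn0) vw.
Qed.

(* Modulo the line of v1 the sums 0, w1, w2, w1 + w2 reach everything, and the *)
(* sums 0, v1, v2, v1 + v2 fill that line.                                     *)
Lemma V_cover (v1 v2 w1 w2 y : V) :
  v1 != 0 -> collinear v1 v2 -> ~~ collinear v1 w1 -> ~~ collinear v1 w2 ->
  w1 != 0 -> w2 != 0 ->
  exists b : bool * bool * (bool * bool),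
    y = v1 *+ b.1.1 + v2 *+ b.1.2 + w1 *+ b.2.1 + w2 *+ b.2.2.
Proof.
move=> v1n0 hv2 hw1 hw2 w1n0 w2n0.
have det_neq0 w : ~~ collinear v1 w -> w != 0 -> V_det v1 w != 0.
  move=> hw wn0; apply: contra hw => /eqP /(V_det_eq0 v1n0).
  by rewrite (negPf wn0).
have [b3 [b4 yw]] :=
  Z3_cover (V_det v1 y) (det_neq0 _ hw1 w1n0) (det_neq0 _ hw2 w2n0).
pose e := y - (w1 *+ b3 + w2 *+ b4).
have e0 : V_det v1 e = 0.
  rewrite -[RHS](subrr (V_det v1 y)) {2}yw /V_det /e /=.
  by case: (b3) (b4) => [] []; rewrite ?mulr1n ?mulr0n /=; ring.
suff [b1 [b2 eE]] : exists b1 b2 : bool, e = v1 *+ b1 + v2 *+ b2.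
  by exists (b1, b2, (b3, b4)); rewrite /= -eE -addrA subrK.
have /or3P[] := V_det_eq0 v1n0 e0 => /eqP ->.
- by exists false, false; rewrite addr0.
- by exists true, false; rewrite addr0.
case/pred2P: hv2 => ->; last by exists false, true; rewrite add0r.
by exists true, true; rewrite !mulr1n (mulr3n_eq0 (V_3 v1)).
Qed.

(** * Subset sums as splittings of a multiset *)

Lemma subsumsP (G : finZmodType) (S : seq G) (g : G) :
  reflect (exists T R : seq G,
             [/\ T != [::], perm_eq S (T ++ R) & g = \sum_(x <- T) x])
          (g \in subsums S).
Proof.
apply: (iffP imsetP) => [[I] | [T [R [Tn0 pS ->]]]].
  rewrite inE => In0 ->.
  exists [seq S`_(i : 'I_(size S)) | i <- enum I].
  exists [seq S`_(i : 'I_(size S)) | i <- enum (~: I)].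
  split; last by rewrite big_map big_enum.
    by apply: contraNneq In0 => /(congr1 size); rewrite size_map -cardE => /eqP;
      rewrite cards_eq0.
  rewrite -map_cat -[S in perm_eq S](mkseq_nth 0) /mkseq.
  rewrite -val_enum_ord -map_comp; apply: perm_map.
  apply: uniq_perm; first exact: enum_uniq.
    rewrite cat_uniq !enum_uniq andbT /=.
    by apply/hasPn => i; rewrite !mem_enum inE.
  by move=> i; rewrite mem_cat !mem_enum /= in_setC orbN.
have /(perm_iotaP 0)[Is pI TR] : perm_eq (T ++ R) S by rewrite perm_sym.
pose J := take (size T) Is.
have TE : T = [seq S`_i | i <- J].
  by rewrite /J map_take -TR take_size_cat.
have Juniq : uniq J by rewrite take_uniq // (perm_uniq pI) iota_uniq.
have Jlt i : i \in J -> (i < size S)%N.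
  by move/mem_take; rewrite (perm_mem pI) mem_iota.
exists [set i : 'I_(size S) | (i : nat) \in J].
  rewrite inE; apply: contraNneq Tn0 => J0; rewrite TE.
  case: (J) J0 Jlt => // j J' J0 /(_ j); rewrite mem_head => /(_ isT) lj.
  by move/setP: J0 => /(_ (Ordinal lj)); rewrite !inE eqxx.
rewrite TE big_map -big_enum /=.
rewrite -[RHS](big_map val predT (fun i => S`_i)); apply: perm_big.
apply: uniq_perm => //.
  by rewrite map_inj_uniq ?enum_uniq //; exact: val_inj.
move=> i; apply/idP/mapP => [iJ | [j]].
  by exists (Ordinal (Jlt _ iJ)); rewrite ?mem_enum ?inE.
by rewrite mem_enum inE => ? ->.
Qed.

Lemma subsums_perm (G : finZmodType) (S S' : seq G) :
  perm_eq S S' -> subsums S = subsums S'.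
Proof.
move=> pS; apply/setP => g; apply/subsumsP/subsumsP => -[T [R [Tn0 pTR ->]]];
  exists T, R; split=> //; apply: perm_trans pTR => //.
by rewrite perm_sym.
Qed.

Lemma subsums_cons (G : finZmodType) (x : G) (b : bool) (S : seq G) (g : G) :
  g \in subsums S -> x *+ b + g \in subsums (x :: S).
Proof.
move=> /subsumsP[T [R [Tn0 pS ->]]]; apply/subsumsP; case: b.
  by exists (x :: T), R; rewrite big_cons /= perm_cons.
exists T, (x :: R); split; rewrite // ?add0r //.
by rewrite perm_sym perm_catC /= perm_cons perm_catC perm_sym.
Qed.

Lemma subsums_cat (G : finZmodType) (m : bitseq) (S S' : seq G) (g : G) :
  g \in subsums S' -> \sum_(x <- mask m S) x + g \in subsums (S ++ S').
Proof.
move=> gS; elim: S m => [|x S IH] [|b m] /=; rewrite ?big_nil ?add0r //.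
  have := subsums_cons x false (IH [::]).
  by rewrite mask0s big_nil !add0r.
have := subsums_cons x b (IH m).
by case: b; rewrite ?big_cons ?add0r // mulr1n addrA.
Qed.

(** * Growth of a set under translation *)

Lemma zmodule_coprime (G : zmodType) (d : G) (m n : nat) :
  coprime m n -> d *+ m = 0 -> d *+ n = 0 -> d = 0.
Proof.
case: m => [|m] co dm dn; first by move: co dn; rewrite /coprime gcd0n => /eqP ->.
have [u v e _] := egcdnP n (ltn0Sn m).
have: d *+ (u * m.+1) = d *+ (v * n + gcdn m.+1 n) by rewrite e.
rewrite (eqP co) mulrnDr (mulnC u) (mulnC v) !mulrnA dm dn !mul0rn.
by rewrite add0r mulr1n.
Qed.

(* If A is stable under translation by d, comparing the sums of the elements *)
(* of A and of d + A gives #|A| d = 0.                                       *)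
Lemma card_translateU (G : finZmodType) (q : nat) (d : G) (A : {set G}) :
  prime q -> d != 0 -> d *+ q = 0 -> A != set0 ->
  (minn q #|A|.+1 <= #|A :|: [set (d + x)%R | x in A]|)%N.
Proof.
move=> q_pr dn0 dq An0; set B := [set _ | _ in _].
have cB : #|B| = #|A| by apply: card_imset; apply: addrI.
have [qA|Aq] := leqP q #|A|.
  by rewrite geq_min (leq_trans qA) // subset_leq_card // subsetUl.
rewrite geq_min; apply/orP; right; rewrite ltnNge; apply/negP => AUB.
have BA : B = A.
  have AE : A = A :|: B by apply/eqP; rewrite eqEcard subsetUl.
  by apply/eqP; rewrite eqEcard cB leqnn andbT AE subsetUr.
have dA : d *+ #|A| = 0.
  have : \sum_(x in A) x = \sum_(x in A) (d + x).
    rewrite -{1}BA big_imset //= => x y _ _; exact: addrI.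
  by rewrite big_split /= sumr_const -{1}[LHS]add0r => /addIr.
case/eqP: dn0; apply: zmodule_coprime dq dA.
by rewrite prime_coprime // gtnNdvd // card_gt0.
Qed.

(** * The lines of [V], and extraction of terms *)

Definition rep1 : V := (0, 1).
Definition rep2 : V := (1, 0).
Definition rep3 : V := (1, 1).
Definition rep4 : V := (1, -1).
(** The projective line over the field with 3 elements: one vector for each of the four lines
    through 0. *)
Definition line_reps : seq V := [:: rep1; rep2; rep3; rep4].

Lemma line_reps_partition (v : V) :
  v != 0 -> sumn [seq (collinear r v : nat) | r <- line_reps] = 1%N.
Proof.
move=> vn0; apply/eqP.
pose P (v : V) := (v != 0) ==>
  (sumn [seq (collinear r v : nat) | r <- line_reps] == 1%N).
have H : all P V_list by vm_compute.
exact: (implyP (V_forall H v) vn0).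
Qed.

Lemma exists_maximal (T : eqType) (s : seq T) (f : T -> nat) :
  s != [::] -> exists2 r, r \in s & forall t, t \in s -> (f t <= f r)%N.
Proof.
elim: s => // x s IH _; have [->|/IH[r rs rmax]] := eqVneq s [::].
  by exists x => [|t]; rewrite inE // => /eqP ->.
have [fxr|frx] := leqP (f x) (f r).
  by exists r => [|t]; rewrite !inE ?rs ?orbT // => /predU1P[-> //|/rmax].
exists x => [|t]; rewrite !inE ?eqxx // => /predU1P[-> //|/rmax ftr].
exact: leq_trans ftr (ltnW frx).
Qed.

Lemma count_pull (T : eqType) (p : pred T) (n : nat) (S : seq T) :
  (n <= count p S)%N ->
  exists A B : seq T, [/\ size A = n, all p A & perm_eq S (A ++ B)].
Proof.
move=> np; exists (take n (filter p S)).
exists (drop n (filter p S) ++ filter (predC p) S); split.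
- by rewrite size_takel // size_filter.
- by apply/allP => x /mem_take; rewrite mem_filter => /andP[].
by rewrite catA cat_take_drop perm_sym perm_filterC.
Qed.

(** * Growth of the sumset in each fiber *)

Section Fibers.

Variables (G : finZmodType) (q : nat) (pi : {additive G -> V}).
Hypothesis q_pr : prime q.
Hypothesis ker_torsion : forall d, pi d = 0 -> d *+ q = 0.

Definition fiber_sums (y : V) (S : seq G) : {set G} :=
  [set g in subsums S | pi g == y].

Definition line_count (r : V) (S : seq G) : nat :=
  count (fun x => collinear r (pi x)) S.

Lemma fiber_perm y S S' : perm_eq S S' -> fiber_sums y S = fiber_sums y S'.
Proof. by move=> pS; rewrite /fiber_sums (subsums_perm pS). Qed.

Lemma fiber_step (T S : seq G) (m1 m2 : bitseq) (k : nat) :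
  \sum_(x <- mask m1 T) x != \sum_(x <- mask m2 T) x ->
  pi (\sum_(x <- mask m1 T) x) = pi (\sum_(x <- mask m2 T) x) ->
  (forall y, (minn q k.+1 <= #|fiber_sums y S|)%N) ->
  forall y, (minn q k.+2 <= #|fiber_sums y (T ++ S)|)%N.
Proof.
set u := \sum_(x <- _) x; set v := \sum_(x <- mask m2 T) x.
move=> uv piuv kS y.
(* [A] consists of sums over y that use v. Replacing v by u translates it by u - v, a nonzero kernel
   element, and stays over y. *)
pose A := [set v + x | x in fiber_sums (y - pi v) S].
have cA : #|A| = #|fiber_sums (y - pi v) S| by apply: card_imset; apply: addrI.
have kA := kS (y - pi v); rewrite -cA in kA.
have q0 := prime_gt0 q_pr.
have An0 : A != set0.
  by rewrite -card_gt0; apply: leq_trans kA; rewrite leq_min q0.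
have d0 : pi (u - v) = 0 by rewrite raddfB piuv subrr.
have := card_translateU q_pr _ (ker_torsion d0) An0; rewrite subr_eq0 => /(_ uv).
set B := A :|: _ => cB.
have BS : B \subset fiber_sums y (T ++ S).
  apply/subsetP => g; rewrite inE => /orP[/imsetP[x] | /imsetP[x' /imsetP[x]]].
    rewrite !inE => /andP[xS /eqP pix] ->.
    by rewrite subsums_cat //= raddfD pix addrC subrK.
  rewrite !inE => /andP[xS /eqP pix] -> ->.
  by rewrite addrA subrK subsums_cat //= raddfD pix piuv addrC subrK.
apply: leq_trans (subset_leq_card BS); apply: leq_trans cB.
by move: kA; move: #|A| => n; lia.
Qed.

(* Up to signs pi a = pi b = pi c. Distinct values give an exchange, and three *)
(* equal values give the pair 0, 3a.                                           *)
Lemma triple_step (a b c : G) :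
  pi a != 0 -> collinear (pi a) (pi b) -> collinear (pi a) (pi c) ->
  ~~ [&& a *+ 3 == 0, collinear a b & collinear a c] ->
  exists m1 m2 : bitseq,
    \sum_(x <- mask m1 [:: a; b; c]) x != \sum_(x <- mask m2 [:: a; b; c]) x /\
    pi (\sum_(x <- mask m1 [:: a; b; c]) x) =
    pi (\sum_(x <- mask m2 [:: a; b; c]) x).
Proof.
move=> an0 ab ac h.
have [abN|abY] := boolP (collinear a b); last first.
  move: abY; rewrite /collinear negb_or => /andP[ba bNa].
  case/pred2P: ab => pib.
    exists [:: false; true], [:: true] => /=; rewrite !big_seq1.
    by rewrite ba pib.
  exists [:: true; true], [::] => /=; rewrite big_cons !big_seq1 big_nil.
  by rewrite addrC addr_eq0 bNa raddfD pib raddf0 addNr.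
have [acN|acY] := boolP (collinear a c); last first.
  move: acY; rewrite /collinear negb_or => /andP[ca cNa].
  case/pred2P: ac => pic.
    exists [:: false; false; true], [:: true] => /=; rewrite !big_seq1.
    by rewrite ca pic.
  exists [:: true; false; true], [::] => /=; rewrite big_cons !big_seq1 big_nil.
  by rewrite addrC addr_eq0 cNa raddfD pic raddf0 addNr.
have {h} a3 : a *+ 3 != 0 by move: h; rewrite abN acN !andbT.
have pa3 : pi (a *+ 3) = 0 by rewrite raddfMn V_3.
suff [m1 [m2 e]] : exists m1 m2 : bitseq,
    \sum_(x <- mask m1 [:: a; b; c]) x =
    \sum_(x <- mask m2 [:: a; b; c]) x + a *+ 3.
  exists m1, m2; rewrite e raddfD pa3 addr0; split=> //.
  by rewrite -subr_eq0 addrC addKr.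
case/pred2P: abN => ->; case/pred2P: acN => ->.
- exists [:: true; true; true], [::].
  by rewrite /= !big_cons big_nil add0r !mulrS mulr0n.
- exists [:: true; true], [:: false; false; true].
  by rewrite /= !big_cons big_nil !addr0 mulrS addKr.
- exists [:: true; false; true], [:: false; true].
  by rewrite /= !big_cons big_nil !addr0 mulrS addKr.
exists [:: true], [:: false; true; true].
by rewrite /= !big_cons big_nil !addr0 !mulrS mulr0n -addrA addKr addKr addr0.
Qed.

Lemma size_line_count (S : seq G) : all (fun x => pi x != 0) S ->
  size S = sumn [seq line_count r S | r <- line_reps].
Proof.
elim: S => // x S IH /= /andP[xn0 /IH ->].
have := line_reps_partition xn0; rewrite /line_count /=; lia.
Qed.

(** Each unit of [k] costs one triple; six terms remain for the base case. Having two terms off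
    every line is the invariant that survives the removals. *)
Lemma fiber_nonzero (k : nat) (S : seq G) :
  all (fun x => pi x != 0) S ->
  (forall a, pi a != 0 -> a *+ 3 = 0 -> (count (collinear a) S <= 2)%N) ->
  (forall r, r \in line_reps -> (line_count r S + 2 <= size S)%N) ->
  (3 * k + 6 <= size S)%N ->
  forall y, (minn q k.+1 <= #|fiber_sums y S|)%N.
Proof.
elim: k S => [|k IH] S Sn0 S3 Sl Ssz y.
all: have [//|r rL rmax] := exists_maximal (s := line_reps) (line_count^~ S).
all: have := size_line_count Sn0; rewrite /= => szE.
all: have rsz := Sl _ rL.
all: have [l1 l2 l3 l4] : [/\ line_count rep1 S <= line_count r S,
  line_count rep2 S <= line_count r S, line_count rep3 S <= line_count r S &
  line_count rep4 S <= line_count r S]%N by split; apply: rmax.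
  (* Six terms on four lines: a largest line has at least two. *)
  have r2 : (2 <= line_count r S)%N by lia.
  have [A [R [szA rA pS]]] := count_pull r2.
  case: A szA rA pS => [|a [|b []]] //= _ /and3P[ra rb _] pS.
  have szS := perm_size pS; rewrite /= in szS.
  have : (2 <= count (fun x => ~~ collinear r (pi x)) R)%N.
    have := count_predC (fun x => collinear r (pi x)) S.
    rewrite -/(line_count r S) (permP pS (predC _)) /= ra rb /=.
    set c := count (predC _) R.
    have -> : c = count (fun x => ~~ collinear r (pi x)) R by [].
    by move: c szS rsz; lia.
  case/count_pull=> A [R' [szA rA pR]].
  case: A szA rA pR => [|c [|d []]] //= _ /and3P[rc rd _] pR.
  have szR := perm_size pR; rewrite /= in szR.
  case: R' pR szR => [|e R'] pR /= szR.
    by move: szS szR Ssz; clear; lia.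
  have pS' : perm_eq S ([:: a; b; c; d] ++ e :: R').
    by apply: perm_trans pS _; rewrite !perm_cons.
  rewrite (fiber_perm _ pS').
  move: Sn0; rewrite (perm_all _ pS') /= => /and5P[an0 bn0 cn0 dn0 _].
  have ninl w : ~~ collinear r w -> ~~ collinear (pi a) w.
    apply: contraNN; apply: collinear_trans.
    by case/pred2P: ra => ->; rewrite /collinear ?opprK eqxx ?orbT.
  have [[[b1 b2] [b3 b4]] /= yE] := V_cover (y - pi e) an0 (collinear_trans ra rb)
    (ninl _ rc) (ninl _ rd) cn0 dn0.
  have eS : e \in subsums (e :: R').
    by apply/subsumsP; exists [:: e], R'; rewrite big_seq1.
  apply: leq_trans (geq_minr _ _) _; rewrite card_gt0; apply/set0Pn.
  exists (\sum_(x <- mask [:: b1; b2; b3; b4] [:: a; b; c; d]) x + e).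
  rewrite inE subsums_cat //= raddfD -[y](subrK (pi e)) yE raddf_sum.
  apply/eqP; congr (_ + _).
  case: b1 b2 b3 b4 {yE} => [] [] [] [];
    by rewrite /= ?big_cons big_nil ?mulr1n ?mulr0n ?addr0 ?add0r ?addrA.
(* Now there are at least nine terms, hence three on a largest line. *)
have r3 : (3 <= line_count r S)%N by lia.
have [A [R [szA rA pS]]] := count_pull r3.
case: A szA rA pS => [|a [|b [|c []]]] //= _ /and4P[ra rb rc _] pS.
rewrite (fiber_perm _ pS).
have szS := perm_size pS; rewrite /= in szS.
move: Sn0; rewrite (perm_all _ pS) /= => /and4P[an0 bn0 cn0 Rn0].
have tri : ~~ [&& a *+ 3 == 0, collinear a b & collinear a c].
  apply/negP => /and3P[/eqP a3 ab ac]; have := S3 a an0 a3.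
  by rewrite (permP pS) /= ab ac /collinear eqxx.
have [m1 [m2 [m12 pm]]] :=
  triple_step an0 (collinear_trans ra rb) (collinear_trans ra rc) tri.
apply: (fiber_step m12 pm) => {}y; apply: IH; first exact: Rn0.
- move=> a' a'n0 a'3; apply: leq_trans (S3 a' a'n0 a'3).
  by rewrite (permP pS) /= !addnA leq_addl.
- have lS s : line_count s S = (collinear s (pi a) + (collinear s (pi b) +
      (collinear s (pi c) + line_count s R)))%N.
    by rewrite /line_count (permP pS) /=.
  have lr : line_count r S = (line_count r R + 3)%N by rewrite lS ra rb rc addn3.
  have lle s : (line_count s R <= line_count s S)%N by rewrite lS !addnA leq_addl.
  have := size_line_count Rn0; rewrite /= => szE'.
  have [k1 k2 k3 k4] := And4 (lle rep1) (lle rep2) (lle rep3) (lle rep4).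
  (* The number of terms off [r] is unchanged. If another line missed at most one of the at least 6
     terms of [R], it would have at least 5, so [r] had at least 5 in [S] and keeps 2 in [R], a
     contradiction. *)
  move=> r' r'L; have := Sl r' r'L.
  clear -rL r'L szE szE' szS Ssz lr l1 l2 l3 l4 k1 k2 k3 k4.
  move: rL r'L; rewrite !inE => /or4P[]/eqP ? /or4P[]/eqP ?; subst r r'; lia.
by move: szS Ssz; clear; lia.
Qed.

End Fibers.

(** * Upper bound *)

Section Upper.

Variables (G : finZmodType) (q : nat) (pi : {additive G -> V}).
Hypothesis q_pr : prime q.
Hypothesis ker_torsion : forall d, pi d = 0 -> d *+ q = 0.

Lemma fiber_kernel (k : nat) (Z S : seq G) :
  all (fun x => (pi x == 0) && (x != 0)) Z ->
  (forall y, (minn q k.+1 <= #|fiber_sums pi y S|)%N) ->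
  forall y, (minn q (size Z + k).+1 <= #|fiber_sums pi y (Z ++ S)|)%N.
Proof.
elim: Z => //= x Z IH /andP[/andP[/eqP pix xn0] Z0] kS.
apply: (@fiber_step G q pi q_pr ker_torsion [:: x] (Z ++ S) [:: true] [::]).
- by rewrite /= big_seq1 big_nil.
- by rewrite /= big_seq1 big_nil pix raddf0.
exact: IH.
Qed.

Hypothesis card_fiber : forall y, (#|[set g | pi g == y]| <= q)%N.
Hypothesis cardG : #|G| = (9 * q)%N.

Lemma zmod_proper (H : {set G}) (n : nat) :
  (#|H| <= n < 9 * q)%N -> H \proper [set: G].
Proof.
move=> /andP[Hn nq].
by rewrite properEcard subsetT cardsT cardG (leq_ltn_trans Hn).
Qed.

(** An upper bound [n] on the order of H suffices; [n] below 9q makes H proper. *)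
Lemma regular_count (S : seq G) (H : {set G}) (n : nat) (p : pred G) :
  regular S -> zmod_closed H -> (#|H| <= n < 9 * q)%N -> {subset p <= H} ->
  (count p S <= n.-1)%N.
Proof.
move=> Sreg HZ Hn pH; have := Sreg _ HZ (zmod_proper Hn).
rewrite size_filter => cS; apply: leq_trans (leq_trans (sub_count pH S) cS) _.
by move: Hn => /andP[Hn _]; rewrite subn1 -!subn1 leq_sub2r.
Qed.

Lemma regular_additive_basis (S : seq G) :
  regular S -> (3 * q + 3 <= size S)%N -> additive_basis S.
Proof.
move=> Sreg Ssz; have q2 := prime_gt1 q_pr.
have S0 : count (pred1 0) S = 0%N.
  apply/eqP; rewrite -leqn0; apply: (@regular_count S [set 0] 1) => //.
  - split=> [|x y]; rewrite !inE // => /eqP -> /eqP ->; by rewrite subr0.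
  - by rewrite cards1; lia.
  - by move=> x; rewrite !inE.
have SK : (count (fun x => pi x == 0%R) S <= q.-1)%N.
  apply: (@regular_count S [set g | pi g == 0] q) => //.
  - split=> [|x y]; rewrite !inE ?raddf0 // raddfB => /eqP -> /eqP ->.
    by rewrite subr0.
  - by rewrite card_fiber; lia.
  - by move=> x; rewrite !inE.
have S3 a : pi a != 0 -> a *+ 3 = 0 -> (count (collinear a) S <= 2)%N.
  move=> _ a3; apply: (@regular_count S (0 |: [set a; - a]) 3) => //.
  - split=> [|x y]; first by rewrite !inE eqxx.
    by rewrite !inE; apply: collinear_sub.
  - rewrite (leq_trans (leq_card_setU _ _).1) ?cards1 ?cards2; first by lia.
    by case: (_ != _).
  - by move=> x xa; rewrite !inE; apply/orP; right; exact: xa.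
have SL r : r \in line_reps ->
    (count (fun x => (pi x == 0%R) || collinear r (pi x)) S <= (3 * q).-1)%N.
  move=> _; pose H := [set g | (pi g == 0) || collinear r (pi g)].
  apply: (@regular_count S H (3 * q)) => //.
  - split=> [|x y]; first by rewrite inE raddf0 eqxx.
    by rewrite !inE raddfB; apply: collinear_sub; apply: V_3.
  - have -> : H = [set g | pi g == 0] :|:
        ([set g | pi g == r] :|: [set g | pi g == - r]).
      by apply/setP => g; rewrite !inE /collinear.
    have h0 := card_fiber 0; have h1 := card_fiber r; have h2 := card_fiber (- r).
    rewrite (leq_trans (leq_card_setU _ _).1); first by lia.
    have h12 := leq_trans (leq_card_setU _ _).1 (leq_add h1 h2).
    apply: leq_trans (leq_add h0 h12) _.
    by clear; lia.
  - by move=> x; rewrite !inE.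
pose Z := [seq x <- S | pi x == 0]; pose R := [seq x <- S | pi x != 0].
have pS : perm_eq S (Z ++ R) by rewrite perm_sym perm_filterC.
have Zsz : (size Z <= q.-1)%N by rewrite size_filter.
have SZR : size S = (size Z + size R)%N by rewrite (perm_size pS) size_cat.
have R0 : all (fun x => pi x != 0) R by exact: filter_all.
(* [R] supplies q - |Z| sums over each point, leaving one further sum for each term of [Z]. *)
have Rfiber y : (minn q (q.-1 - size Z).+1 <= #|fiber_sums pi y R|)%N.
  apply: (@fiber_nonzero G q pi q_pr ker_torsion) => //.
  - move=> a an0 a3; apply: leq_trans (S3 a an0 a3).
    by rewrite (permP pS) count_cat leq_addl.
  - move=> r rL; have := SL r rL; rewrite (permP pS) count_cat.
    have -> : count (fun x => (pi x == 0) || collinear r (pi x)) Z = size Z.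
      apply/eqP; rewrite -all_count; apply/allP => x.
      by rewrite mem_filter => /andP[->].
    have -> : count (fun x => (pi x == 0) || collinear r (pi x)) R =
        line_count pi r R.
      by apply: eq_in_count => x; rewrite mem_filter => /andP[/negPf ->].
    (* At most 3q - 1 - |Z| of the at least 3q + 3 - |Z| terms of [R] lie on the line. *)
    move: Ssz; rewrite SZR; move: (size Z) (size R) (line_count pi r R).
    by move: q2; clear; lia.
  move: Ssz; rewrite SZR; move: (size Z) (size R) Zsz.
  by move: q2; clear; lia.
have Z0 : all (fun x => (pi x == 0) && (x != 0)) Z.
  apply/allP => x; rewrite mem_filter => /andP[-> xS]; apply/eqP => x0.
  by move/eqP: S0; rewrite -leqn0 leqNgt -has_count has_pred1 -x0 xS.
have Sfiber y : (q <= #|fiber_sums pi y S|)%N.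
  have := fiber_kernel Z0 Rfiber y.
  by rewrite -(fiber_perm _ _ pS) subnKC // prednK ?minnn // prime_gt0.
apply/setP => g; rewrite inE.
have sub : fiber_sums pi (pi g) S \subset [set h | pi h == pi g].
  by apply/subsetP => h; rewrite !inE => /andP[].
have /eqP/setP/(_ g) : fiber_sums pi (pi g) S == [set h | pi h == pi g].
  by rewrite eqEcard sub (leq_trans (card_fiber _)).
by rewrite !inE eqxx andbT.
Qed.

End Upper.

Lemma c0_upper (q : nat) : prime q ->
  c0_bound ('Z_3 * 'Z_(3 * q))%type (3 * q + 3).
Proof.
move=> q_pr S; have q1 := prime_gt1 q_pr; have q0 := prime_gt0 q_pr.
have q31 : (1 < 3 * q)%N by lia.
have Zq := Zp_cast q31.
have dvd3 : (3 %| (Zp_trunc (3 * q)).+2)%N by rewrite Zq dvdn_mulr.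
(* Reduction of the second coordinate mod 3, additive because 3 divides 3q. *)
pose f (g : 'Z_3 * 'Z_(3 * q)) : V := (g.1, (g.2 : nat)%:R).
have fD : nmod_morphism f.
  split=> [|[x y] [x' y']]; rewrite /f //=; congr pair.
  rewrite -[RHS]natrD; apply/val_inj.
  by rewrite /= !val_Zp_nat // modn_dvdm.
pose pi : {additive _ -> _} := HB.pack f (GRing.isNmodMorphism.Build _ _ f fD).
apply: (@regular_additive_basis _ q pi q_pr).
- move=> [x y] [-> /(congr1 val)]; rewrite /= val_Zp_nat // => /eqP y3.
  rewrite pair_mulrn mul0rn; congr pair.
  rewrite -[y]natr_Zp -mulrnA; apply/val_inj; rewrite /= val_Zp_nat //.
  by apply/eqP; rewrite -/(dvdn _ _) dvdn_pmul2r.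
- move=> y; pose g (i : 'I_q) : 'Z_3 * 'Z_(3 * q) := (y.1, (y.2 + i * 3)%:R).
  rewrite -[X in (_ <= X)%N]card_ord; apply: leq_trans (leq_imset_card g _).
  apply/subset_leq_card/subsetP => -[u v]; rewrite inE => /eqP yE.
  have vq : (v %/ 3 < q)%N.
    rewrite ltn_divLR // [(q * 3)%N]mulnC.
    by apply: leq_trans (ltn_ord v) _; rewrite Zq.
  apply/imsetP; exists (Ordinal vq) => //; rewrite /g -yE; congr pair.
  by rewrite /= val_Zp_nat // addnC -divn_eq natr_Zp.
by rewrite card_prod !card_ord Zq mulnA.
Qed.

(** * Lower bound *)

Lemma zmod_closedMnD (G : zmodType) (H : {pred G}) (x y : G) (m n : nat) :
  zmod_closed H -> x \in H -> y \in H -> x *+ m + y *+ n \in H.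
Proof.
case=> H0 HS xH yH.
have HD u v : u \in H -> v \in H -> u + v \in H.
  by move=> uH vH; rewrite -[v]opprK -[- v]sub0r; apply: (HS) => //; apply: HS.
have HM u k : u \in H -> u *+ k \in H.
  by move=> uH; elim: k => [|k IH]; rewrite ?mulr0n // mulrS HD.
by rewrite HD ?HM.
Qed.

Lemma sum_two_values (G : zmodType) (a b : G) (T : seq G) : a != b ->
  all (pred2 a b) T ->
  \sum_(x <- T) x = a *+ count_mem a T + b *+ count_mem b T.
Proof.
move=> ab; elim: T => [_|x T IH /= /andP[/pred2P xab /IH IT]].
  by rewrite big_nil !mulr0n addr0.
rewrite big_cons IT; case: xab => ->; rewrite eqxx.
  by rewrite (negPf ab) add0n add1n mulrS addrA.
by rewrite eq_sym (negPf ab) add0n add1n mulrS addrCA.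
Qed.

Lemma c0_lower (q t : nat) : prime q -> (5 <= q)%N ->
  c0_bound ('Z_3 * 'Z_(3 * q))%type t -> (3 * q + 3 <= t)%N.
Proof.
move=> q_pr q5 tP; rewrite leqNgt; apply/negP => tlt.
have q31 : (1 < 3 * q)%N by lia.
have Zq := Zp_cast q31.
pose G : finZmodType := ('Z_3 * 'Z_(3 * q))%type.
pose a : G := (0, 1); pose b : G := (1, 1).
pose S : seq G := nseq (3 * q - 2) a ++ nseq 4 b.
have ab : a != b by [].
have cS p : count p S = (p a * (3 * q - 2) + p b * 4)%N.
  by rewrite count_cat !count_nseq.
have Sreg : regular S.
  move=> H HZ Hprop; rewrite size_filter cS.
  (* A subgroup containing [a] or [b] has at least 3q elements, more than 3q - 2 and more than 4.
     One containing both contains b - a = (1, 0) as well, hence is all of G. *)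
  have H3q x : x \in H -> x.2 = 1 -> (3 * q <= #|H|)%N.
    move=> xH x2.
    pose g (i : 'I_(3 * q)) : G := x *+ i.
    have ginj : injective g.
      move=> i j /(congr1 snd).
      rewrite /g [x]surjective_pairing !pair_mulrn /= x2.
      move/(congr1 val); rewrite /= !val_Zp_nat // !modn_small // => ij.
      exact: val_inj.
    rewrite -[X in (X <= _)%N]card_ord -(card_imset _ ginj).
    apply: subset_leq_card; apply/subsetP => _ /imsetP[i _ ->].
    by have := zmod_closedMnD i 0 HZ xH xH; rewrite mulr0n addr0.
  have [aH|aH] := boolP (a \in H); have [bH|bH] := boolP (b \in H).
  - case/negP: (proper_subn Hprop); apply/subsetP => -[x y] _.
    have baH : b - a \in H by case: HZ => _; apply.
    have := zmod_closedMnD x y HZ baH aH.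
    rewrite (_ : b - a = (1, 0)); last by congr pair; rewrite /= ?subr0 ?subrr.
    rewrite !pair_mulrn [_ + _](_ : _ = (x, y)) //.
    by congr pair; rewrite /= ?mul0rn ?addr0 ?add0r natr_Zp.
  - by have := H3q a aH erefl; lia.
  - by have := H3q b bH erefl; lia.
  by [].
have Ssz : (t <= size S)%N by rewrite size_cat !size_nseq; lia.
have /setP/(_ ((1 + 1, 1) : G)) := tP S Sreg Ssz; rewrite inE => /subsumsP.
case=> T [R [_ pS]].
have cT p : (count p T <= count p S)%N by rewrite (permP pS) count_cat leq_addr.
have Tab : all (pred2 a b) T.
  apply/allP => x xT; have : x \in S by rewrite (perm_mem pS) mem_cat xT.
  rewrite mem_cat !mem_nseq => /orP[] /andP[_ /eqP ->]; apply/pred2P;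
    [by left | by right].
rewrite (sum_two_values ab Tab).
have := cT (pred1 a); have := cT (pred1 b).
rewrite !cS !simpl_predE !eqxx [b == a]eq_sym (negPf ab).
rewrite !mul0n !mul1n addn0 add0n.
move: (count_mem a T) (count_mem b T) => i j j4 i3.
rewrite !pair_mulrn => E; move: (congr1 fst E) (congr1 snd E) => /=.
rewrite mul0rn add0r -mulrnDr => /(congr1 val) e1 /(congr1 val) e2.
move: e1 e2; rewrite /= !val_Zp_nat //.
rewrite Zq -[LHS in LHS = _ -> _]/2%N (modn_small q31) => j2.
have {j2 j4} -> : j = 2%N by case: j j4 j2 {E} => [|[|[|[|[|]]]]].
(* Here i + 2 should be 1 mod 3q, but i <= 3q - 2, so its residue is i + 2 itself or, when i + 2 =
   3q, zero. *)
have [lt|] := ltnP (i + 2) (3 * q); first by rewrite modn_small //; lia.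
move=> le; have -> : (i + 2)%N = (3 * q)%N by lia.
by rewrite modnn.
Qed.

Local Close Scope ring_scope.

Theorem theorem1p1 (q : nat) (q_prime : prime q) (q_ge5 : 5 <= q) :
  is_c0 ('Z_3 * 'Z_(3 * q))%type (3 * q + 3).
Proof.
split; first exact: c0_upper.
by move=> t; apply: c0_lower.
Qed.
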